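(* For all integers $n,k\ge0$, the integer $|v(n,k)|$, where $v(n,k)=4^{n-k}t(2n+1,2k+1)$, is the number of $(n,k)$-Riordan complexes.
   Context: $t(m,k)$ are the central factorial numbers of the first kind. Equivalently, $|v(n,k)|$ is the coefficient of $t^{2k+1}$ in $t(t^2+1^2)(t^2+3^2)\cdots(t^2+(2n-1)^2)$ (the empty product for $n=0$ giving $t$); also $v(0,0)=1$, $v(0,k)=0$ for $k\ge1$, $v(n,-1)=0$, and $v(n,k)=v(n-1,k-1)-(2n-1)^2v(n-1,k)$ for $n\ge1$. An $(n,k)$-Riordan complex is a $(2k+1)$-tuple $((B_1,\sigma_1,\tau_1),\dots,(B_{2k+1},\sigma_{2k+1},\tau_{2k+1}))$ such that (i) $\{B_1,\dots,B_{2k+1}\}$ is a partition of $\{1,\dots,2n+1\}$ into blocks of odd cardinality, and (ii) for each $i$, $\sigma_i$ and $\tau_i$ are fixed-point-free involutions of $B_i\setminus\{\max(B_i)\}$.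
   Formalization: Riordan complexes are counted up to reordering of the blocks, i.e. as a set partition with two involutions per block; counted as ordered tuples the claim fails (n=k=1 would give 3!=6 tuples, but |v(1,1)|=1). *)

(* Defs.v *)
From mathcomp Require Import all_boot all_order all_algebra.
Set Implicit Arguments. Unset Strict Implicit. Unset Printing Implicit Defensive.
Import GRing.Theory Num.Theory.
Local Open Scope ring_scope.

(* v(n,k) defined by the recurrence of the paper:
   v(0,0)=1, v(0,k)=0 (k>=1), v(n,-1)=0,
   v(n,k) = v(n-1,k-1) - (2n-1)^2 v(n-1,k)  (n >= 1).
   In the branch n = n'.+1 we have 2n-1 = 2n'+1. *)
Fixpoint v (n k : nat) : int :=
  match n with
  | 0 => (k == 0%N)%:Z
  | n'.+1 =>
      (match k with 0 => 0 | k'.+1 => v n' k' end)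
      - ((2 * n' + 1) ^ 2)%N%:Z * v n' k
  end.

(* The ground set {1,...,2n+1} is represented by 'I_(2n+1) = {0,...,2n}
   (shift by one, which preserves the order and hence maxima). *)
Section Riordan.
Variable N : nat.
Local Notation T := 'I_N.

Definition nonmax (B : {set T}) : {set T} :=
  [set x in B | [exists y in B, (x < y)%N]].

Definition fpf_invol_on (A : {set T}) (s : {ffun T -> T}) : bool :=
  [forall x in A, [&& s x \in A, s x != x & s (s x) == x]].

(* A Riordan complex is encoded as (P, s, t): P is the set of blocks
   {B_1,...,B_(2k+1)} and, for each block B, sigma_B (resp. tau_B) is the
   restriction of s (resp. t) to B \ {max B}; s and t fix the block maxima
   (so the data (P,s,t) is in bijection with the family (B, sigma_B, tau_B)). *)
Definition riordan_complex (k : nat)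
    (c : {set {set T}} * {ffun T -> T} * {ffun T -> T}) : bool :=
  let: (P, s, t) := c in
  [&& partition P [set: T],
      #|P| == (2 * k + 1)%N,
      [forall B in P, odd #|B|],
      [forall B in P, fpf_invol_on (nonmax B) s && fpf_invol_on (nonmax B) t]
    & [forall B in P, forall x in B, (x \notin nonmax B) ==> (s x == x) && (t x == x)]].

End Riordan.

(* Main.v *)
(** Let A be the series arcsin x.  A block of size j carries d(j-1)^2 pairs of
    fixed-point-free involutions, where d(i) is the number of perfect matchings
    of i points, and d(j-1)^2 is the j-th coefficient of the exponential
    generating series A (it vanishes for even j, so the parity condition is
    automatic).  Hence Riordan complexes with m blocks are counted by the
    coefficients of y_m = A^m/m!.  From (1 - x^2) A'^2 = 1 and
    (1 - x^2) A'' = x A' one gets (1 - x^2) y_m'' = x y_m' + y_{m-2}; on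
    coefficients this is y_m(n+2) = n^2 y_m(n) + y_{m-2}(n), the recurrence of v
    up to the sign (-1)^(n+k). *)
Require Import Defs.
From mathcomp Require Import all_boot all_order all_algebra all_fingroup.
From mathcomp Require Import ring.
Set Implicit Arguments. Unset Strict Implicit. Unset Printing Implicit Defensive.
Import GRing.Theory.
Local Open Scope ring_scope.

(** * Calculus of exponential generating series on coefficient sequences *)

Section BinomialConvolution.
Variable R : comNzRingType.
Implicit Types f g : nat -> R.

(** Read [f] as the series with coefficient [f n] at x^n/n!. Then [conv] is the product, [shift] the
    derivative and [mulX] multiplication by x; the value of [n.-1] at 0 is harmless because of the
    factor 0. *)
Definition conv f g (n : nat) : R :=
  \sum_(i < n.+1) 'C(n, i)%:R * f i * g (n - i)%N.

Definition shift f (n : nat) : R := f n.+1.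

Definition mulX f (n : nat) : R := n%:R * f n.-1.

Lemma eq_conv f1 f2 g1 g2 : f1 =1 f2 -> g1 =1 g2 -> conv f1 g1 =1 conv f2 g2.
Proof. by move=> ef eg n; apply: eq_bigr => i _; rewrite ef eg. Qed.

Lemma convC f g : conv f g =1 conv g f.
Proof.
move=> n; rewrite /conv (reindex_inj rev_ord_inj) /=; apply: eq_bigr => i _.
by rewrite subSS bin_sub -1?ltnS // subKn -1?ltnS //; ring.
Qed.

Lemma convD f g h n : conv f (fun i => g i + h i) n = conv f g n + conv f h n.
Proof. by rewrite -big_split; apply: eq_bigr => i _; rewrite mulrDr. Qed.

Lemma shift_conv f g n :
  conv f g n.+1 = conv (shift f) g n + conv f (shift g) n.
Proof.
rewrite /conv big_ord_recl /= bin0 subn0.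
under eq_bigr => i _ do rewrite /bump /= add1n subSS binS natrD !mulrDl.
rewrite big_split /= addrA [RHS]addrC; congr (_ + _).
rewrite big_ord_recr /= bin_small // !mul0r addr0 [RHS]big_ord_recl /= bin0 subn0.
congr (_ + _); apply: eq_bigr => i _.
by rewrite /bump /= add1n /shift -subSn.
Qed.

Lemma mulX_convr f g : mulX (conv f g) =1 conv f (mulX g).
Proof.
case=> [|n]; first by rewrite /mulX /conv mul0r big_ord1 /= mul0r mulr0.
rewrite /mulX /conv [RHS]big_ord_recr /= subnn !(mul0r, mulr0) addr0 mulr_sumr.
apply: eq_bigr => i _; have le_in : (i <= n)%N by rewrite -ltnS.
rewrite subSn //= -subSn //.
have /(congr1 (fun m : nat => m%:R : R)) := mul_bin_down n.+1 i.
rewrite !natrM /= => e.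
by rewrite !mulrA e; ring.
Qed.

Lemma mulX_convl f g : mulX (conv f g) =1 conv (mulX f) g.
Proof.
move=> n; rewrite [RHS]convC -mulX_convr /mulX.
by rewrite [conv f g _]convC.
Qed.

End BinomialConvolution.

(** * Powers of the arcsine series and their differential equations *)

Fixpoint matchings (n : nat) : nat :=
  match n with
  | 0 => 1
  | 1 => 0
  | (m.+1 as p).+1 => p * matchings m
  end.

Section ArcsinePowers.
Variable R : comNzRingType.

Definition arcsin' (n : nat) : R := ((matchings n) ^ 2)%:R.

Fixpoint arcsin_pow (m : nat) : nat -> R :=
  match m with
  | 0 => fun n => (n == 0)%:R
  | m'.+1 => fun n => if n is n'.+1 then conv arcsin' (arcsin_pow m') n' else 0
  end.

Local Notation a := arcsin'.
Local Notation f := arcsin_pow.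

(** The equation (1 - x^2) A'' = x A', moved to a form without subtraction; on coefficients it is
    the square of the recurrence of [matchings]. *)
Lemma arcsin'_ode n : shift a n = mulX (mulX (shift a)) n + mulX a n.
Proof.
case: n => [|[|n]]; rewrite /shift /mulX ?mul0r ?addr0 //=.
  by rewrite /a /=; ring.
have -> : a n.+3 = n.+2%:R ^+ 2 * a n.+1.
  by rewrite /a -natrX -natrM -expnMn.
by rewrite -!natr1; ring.
Qed.

Lemma conv_arcsin'_ode g n : conv (shift a) g n =
  mulX (mulX (conv (shift a) g)) n + mulX (conv a g) n.
Proof.
rewrite (eq_conv arcsin'_ode (frefl g)) convC convD ![conv g _ n]convC.
rewrite -!mulX_convl; congr (_ + _); rewrite {1 3}/mulX.
by rewrite mulX_convl.
Qed.

(** The series y_(m-1), with the convention y_(-1) = 0. *)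
Definition arcsin_pow_pred m := if m is m'.+1 then f m' else fun _ => 0.

Lemma arcsin_pow_ode m n : shift (shift (f m.+1)) n =
  mulX (mulX (shift (shift (f m.+1)))) n + mulX (shift (f m.+1)) n
  + arcsin_pow_pred m n.
Proof.
elim: m n => [|m IH] n.
  have e : conv a (f 0) =1 a.
    move=> i; rewrite /conv big_ord_recr /= binn subnn eqxx !mulr1 mul1r big1 ?add0r //.
    by move=> j _; rewrite subn_eq0 leqNgt ltn_ord mulr0.
  have e1 i : shift (shift (f 1)) i = shift a i by rewrite /shift /= e.
  have e2 i : shift (f 1) i = a i by rewrite /shift /= e.
  by rewrite addr0 /mulX !e1 e2; apply: arcsin'_ode.
(* [h] is the series A'^2 A^m/m!, so this says (1 - x^2) A'^2 = 1 after
   multiplication by A^m/m!; both sides have the same derivative. *)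
have K i : conv a (shift (f m.+1)) i =
    mulX (mulX (conv a (shift (f m.+1)))) i + f m i.
  set h := conv a (shift (f m.+1)).
  case: i => [|i].
    rewrite /mulX mul0r add0r /h /conv /shift /= big_ord1 /=.
    by rewrite /conv big_ord1 /= /a !mul1r.
  (* By the product rule, h' has one term with A'' and one with y_(m+1)''. [Da] treats the first by
     the equation for A', [Dg] the second by [IH] multiplied by A'. Together (1 - x^2) h' = 2 x h +
     y_m', the derivative of the claim. *)
  have Da := conv_arcsin'_ode (shift (f m.+1)) i.
  have Dg : conv a (shift (shift (f m.+1))) i =
      mulX (mulX (conv a (shift (shift (f m.+1))))) i + mulX h i + f m i.+1.
    rewrite (eq_conv (frefl a) IH) !convD -!mulX_convr; congr (_ + _ + _).
      by rewrite {1 3}/mulX mulX_convr.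
    (* A' y_(m-1) = y_m' holds by definition for positive m; for m = 0 both sides vanish. *)
    case: (m) => [|m'] //=; rewrite /arcsin_pow_pred /conv big1 // => j _.
    by rewrite mulr0.
  have Dh j : h j.+1 = conv (shift a) (shift (f m.+1)) j
      + conv a (shift (shift (f m.+1))) j by apply: shift_conv.
  rewrite Dh Da Dg -/h.
  case: i {Da Dg} => [|[|i]]; rewrite /mulX /=; try ring.
  by rewrite Dh -!natr1; ring.
(* Differentiate y_(m+2)' = A' y_(m+1). Multiplied by 1 - x^2, the term with A'' becomes x y_(m+2)'
   and the other becomes y_m by [K]. *)
have e i : shift (shift (f m.+2)) i =
    conv (shift a) (f m.+1) i + conv a (shift (f m.+1)) i by apply: shift_conv.
have e' i : shift (f m.+2) i = conv a (f m.+1) i by [].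
rewrite e conv_arcsin'_ode K /mulX !e e' /=.
by ring.
Qed.

(** The operators x^2 y'' and x y' multiply the n-th coefficient by n(n-1) and n, which add up to
    n^2. *)
Lemma arcsin_pow_rec m n :
  f m.+1 n.+2 = n%:R ^+ 2 * f m.+1 n + arcsin_pow_pred m n.
Proof.
have := arcsin_pow_ode m n; rewrite /shift => ->; congr (_ + _).
by case: n => [|[|n]]; rewrite /mulX /=; ring.
Qed.

End ArcsinePowers.

(** * Counting matchings that respect a colouring *)

Section Matchings.
Variables (T C : finType) (c : T -> C).
Implicit Types (A : {set T}) (s : {ffun T -> T}).

(** With [c] sending a point to its block, a single function on [T] carries the matchings of all
    blocks at once; being the identity off [A] makes the encoding unique. *)
Definition class_matching A s : bool :=
  [forall x, if x \in A
     then [&& s x \in A, s x != x, s (s x) == x & c (s x) == c x]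
     else s x == x].

Lemma class_matchingP A s :
  reflect ((forall x, x \in A -> [/\ s x \in A, s x != x, s (s x) = x & c (s x) = c x])
           /\ forall x, x \notin A -> s x = x)
          (class_matching A s).
Proof.
apply: (iffP forallP) => [h | [h1 h2] x].
  split=> x xA; move: (h x); first by rewrite xA => /and4P[-> -> /eqP-> /eqP->].
  by rewrite (negbTE xA) => /eqP.
by case: ifPn => [/h1[-> -> -> ->] | /h2->]; rewrite ?eqxx.
Qed.

Definition twist (x y : T) s : {ffun T -> T} := [ffun z => s (tperm x y z)].

Lemma twistK x y : involutive (twist x y).
Proof. by move=> s; apply/ffunP => z; rewrite !ffunE tpermK. Qed.

(** Composing with the transposition of x and y exchanges the matchings that pair x with y and those
    that leave both points fixed. *)
Lemma class_matching_twist A x y s : x \in A -> y \in A -> y != x -> c y = c x ->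
  class_matching A (twist x y s) && (twist x y s x == y)
  = class_matching (A :\ x :\ y) s.
Proof.
move=> xA yA yx cxy.
have tD z : z != x -> z != y -> twist x y s z = s z.
  by move=> zx zy; rewrite ffunE tpermD // eq_sym.
have tL : twist x y s x = s y by rewrite ffunE tpermL.
have tR : twist x y s y = s x by rewrite ffunE tpermR.
apply/andP/class_matchingP => [[/class_matchingP[h1 h2]] | [h1 h2]].
  rewrite tL => /eqP sy.
  have sx : s x = x by have [_ _] := h1 x xA; rewrite tL sy tR.
  split=> z; rewrite !inE; last first.
    have [-> //|zy] := eqVneq z y; have [-> //|zx] := eqVneq z x.
    by move=> /= zA; rewrite -(tD z) // h2.
  case/and3P=> zy zx zA; have [] := h1 z zA; rewrite (tD z) // => szA sz.
  have szx : s z != x by apply: contra_neq (zy) => e;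
    have [_ _] := h1 z zA; rewrite (tD z) // e tL sy.
  have szy : s z != y by apply: contra_neq (zx) => e;
    have [_ _] := h1 z zA; rewrite (tD z) // e tR sx.
  by rewrite tD // szA szx szy => -> ->.
have sy : s y = y by apply: h2; rewrite !inE eqxx.
have sx : s x = x by apply: h2; rewrite !inE eqxx andbF.
split; last by rewrite tL sy.
apply/class_matchingP; split=> z zA.
  have [->|zx] := eqVneq z x; first by rewrite tL sy tR sx cxy.
  have [->|zy] := eqVneq z y; first by rewrite tR sx tL sy cxy eq_sym.
  have [|] := h1 z; rewrite !inE ?zx ?zy //= => /and3P[szy szx szA] sz ssz csz.
  by rewrite (tD z) // tD.
have zx : z != x by apply: contraNneq zA => ->.
have zy : z != y by apply: contraNneq zA => ->.
by rewrite tD // h2 // !inE (negbTE zA) !andbF.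
Qed.

Lemma card_class_matching A :
  #|class_matching A| = (\prod_j matchings #|[set x in A | c x == j]|)%N.
Proof.
have [n] := ubnP #|A|; elim: n A => // n IH A /ltnSE leAn.
have [->|[x xA]] := set_0Vmem A.
  rewrite big1 => [|j _]; last first.
    by rewrite (_ : [set _ in _ | _] = set0) ?cards0 //; apply/setP=> z; rewrite !inE.
  rewrite -(card1 [ffun z : T => z]); apply: eq_card => s; rewrite !inE.
  apply/class_matchingP/eqP => [[_ h]|->].
    by apply/ffunP => z; rewrite ffunE h // inE.
  by split=> z; rewrite ?inE // ffunE.
have yP s y : class_matching A s && (s x == y) -> [&& y \in A, y != x & c y == c x].
  case/andP=> /class_matchingP[/(_ _ xA)[h1 h2 h3 h4] _] /eqP<-.
  by apply/and3P; split=> //; apply/eqP.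
(* [K] holds the possible partners of x. Each choice removes two points from the class of x and
   leaves the other classes unchanged. *)
set K := [set y in A | (y != x) && (c y == c x)].
have cK : #|[set z in A | c z == c x]| = #|K|.+1.
  rewrite (cardsD1 x) !inE xA eqxx; congr _.+1; apply: eq_card => z; rewrite !inE.
  by rewrite andbCA.
rewrite -sum1_card (partition_big (fun s => s x) [in K]) /=; last first.
  by move=> s hs; rewrite inE; apply: (yP s); apply/andP; split.
rewrite (bigD1 (c x)) //= cK.
under eq_bigr => y yK.
  rewrite (reindex_inj (inv_inj (twistK x y))) /=.
  move: (yK); rewrite inE => /and3P[yA yx /eqP cy].
  under eq_bigl => s do rewrite unfold_in class_matching_twist //.
  rewrite sum1_card IH; last first.
    by move: leAn; rewrite (cardsD1 x) xA (cardsD1 y) !inE yx yA; move/ltnW.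
  rewrite (bigD1 (c x)) //=.
  have -> : #|[set z in A :\ x :\ y | c z == c x]| = #|K|.-1.
    rewrite (cardsD1 y K) yK /=; apply: eq_card => z; rewrite !inE.
    by case: (z == y); case: (z == x); case: (z \in A).
  under eq_bigr => j jx.
    have -> : [set z in A :\ x :\ y | c z == j] = [set z in A | c z == j].
      apply/setP=> z; rewrite !inE.
      have [->|_] := eqVneq z y.
        by rewrite cy [c x == j]eq_sym (negbTE jx) !andbF.
      have [->|//] := eqVneq z x.
      by rewrite [c x == j]eq_sym (negbTE jx) !andbF.
    over.
  over.
rewrite sum_nat_const mulnA; congr (_ * _)%N.
(* What remains is the recurrence of [matchings]; an empty [K] gives 0 on both sides. *)
by case: #|K|.
Qed.

End Matchings.

(** * Weighted sums over set partitions with a given number of blocks *)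

Section PartitionSums.
Variable T : finType.
Implicit Types (A B : {set T}) (P Q : {set {set T}}).

Lemma sum_subset_card (V : nmodType) A (F : nat -> V) :
  \sum_(B : {set T} | B \subset A) F #|B| = \sum_(i < #|A|.+1) F i *+ 'C(#|A|, i).
Proof.
rewrite (partition_big (fun B => inord #|B| : 'I_(#|A|.+1)) predT) //=.
apply: eq_bigr => i _; rewrite -cards_draws -sumr_const.
have e B : (B \subset A) && (inord #|B| == i :> 'I_(#|A|.+1)) =
    (B \in [set B' : {set T} | B' \subset A & #|B'| == i]).
  rewrite inE; case: (boolP (B \subset A)) => //= /subset_leq_card leBA.
  by rewrite -val_eqE /= inordK.
rewrite (eq_bigl _ _ e); apply: eq_bigr => B.
by rewrite inE => /andP[_ /eqP->].
Qed.

Variables (R : comNzRingType) (w : nat -> R).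

Definition partition_sum m A : R :=
  \sum_(P | partition P A && (#|P| == m)) \prod_(B in P) w #|B|.

(** Split off the block B containing x; the other blocks partition the complement of B. *)
Lemma partition_sum_rec m A x : x \in A ->
  partition_sum m.+1 A =
    \sum_(B : {set T} | (B \subset A) && (x \in B)) w #|B| * partition_sum m (A :\: B).
Proof.
move=> xA; rewrite /partition_sum.
rewrite (partition_big (fun P => pblock P x)
  (fun B : {set T} => (B \subset A) && (x \in B))) /=; last first.
  move=> P /andP[partP _]; have xP : x \in cover P by rewrite (cover_partition partP).
  by rewrite (partitionS partP) ?pblock_mem // mem_pblock.
apply: eq_bigr => B /andP[BA xB].
rewrite (reindex_onto (fun Q => B |: Q) (fun P => P :\ B)) /=; last first.
  move=> P /andP[/andP[partP _] /eqP <-]; rewrite setD1K // pblock_mem //.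
  by rewrite (cover_partition partP).
rewrite mulr_sumr; apply: eq_big => [Q | Q /andP[_ /eqP e]]; last first.
  by rewrite big_setU1 // -e !inE eqxx.
apply/idP/idP => [/andP[/andP[/andP[partQ cQ] _] /eqP e]|].
  have BQ : B \notin Q by rewrite -e !inE eqxx.
  move: cQ; rewrite cardsU1 BQ eqSS => ->; rewrite andbT -e.
  by apply: partitionD1 => //; rewrite !inE eqxx.
case/andP=> partQ /eqP cQ.
have BQ : B \notin Q.
  apply/negP => BQ; have /subsetP/(_ x xB) := partitionS partQ BQ.
  by rewrite !inE xB.
have partBQ : partition (B |: Q) A.
  rewrite -(setID A B) (setIidPr BA).
  apply: partitionU1 => //; first by apply/set0Pn; exists x.
  by rewrite -setI_eq0; apply/eqP/setP=> z; rewrite !inE; case: (z \in B).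
rewrite partBQ cardsU1 BQ cQ eqxx setU1K // eqxx andbT /=.
by rewrite (def_pblock (partition_trivIset partBQ) _ xB) // !inE eqxx.
Qed.

End PartitionSums.

(** Once x is removed, its block is an arbitrary subset of the other points, so the recurrence of
    the partition sum is the binomial convolution defining [arcsin_pow]. *)
Lemma partition_sum_arcsin (T : finType) (R : comNzRingType) m (A : {set T}) :
  partition_sum (fun j => arcsin' R j.-1) m A = arcsin_pow R m #|A|.
Proof.
elim: m A => [|m IH] A.
  rewrite /partition_sum /= cards_eq0.
  have e P : partition P A && (#|P| == 0)%N = (P == set0) && (A == set0).
    rewrite cards_eq0 andbC; have [->|//] := eqVneq P set0; rewrite /=.
    apply/idP/eqP => [partP | ->]; last by rewrite partition_set0.
    by rewrite -(cover_partition partP) /cover big_set0.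
  rewrite (eq_bigl _ _ e).
  case: (A == set0); last by rewrite big_pred0 // => P; rewrite andbF.
  by under eq_bigl do rewrite andbT; rewrite big_pred1_eq big_set0.
have [->|[x xA]] := set_0Vmem A.
  rewrite cards0 /partition_sum big_pred0 // => P; rewrite partition_set0.
  by case: eqP => [->|//]; rewrite cards0.
rewrite (partition_sum_rec _ _ xA) (cardsD1 x) xA /=.
rewrite (reindex_onto (fun B => x |: B) (fun B => B :\ x)) /=; last first.
  by move=> B /andP[_ xB]; rewrite setD1K.
have e B : [&& x |: B \subset A, x \in x |: B & (x |: B) :\ x == B] = (B \subset A :\ x).
  rewrite setU11 /= subUset sub1set xA subsetD1; congr (_ && _).
  apply/eqP/idP => [<-|xB]; first by rewrite !inE eqxx.
  by rewrite setU1K.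
under eq_bigl => B do rewrite -andbA e.
set n := #|A :\ x|.
transitivity (\sum_(B : {set T} | B \subset A :\ x)
    (arcsin' R #|B| * arcsin_pow R m (n - #|B|))).
  apply: eq_bigr => B; rewrite subsetD1 => /andP[BA xB].
  rewrite cardsU1 xB IH; congr (_ * arcsin_pow R m _).
  by rewrite -setDDl cardsDS // subsetD1 BA.
rewrite (sum_subset_card _ (fun i => arcsin' R i * arcsin_pow R m (n - i))).
by apply: eq_bigr => i _; rewrite -[LHS]mulr_natl mulrA.
Qed.

(** * Riordan complexes as pairs of matchings over a partition *)

Lemma card_nonmax N (B : {set 'I_N}) : #|nonmax B| = #|B|.-1.
Proof.
have [->|[z zB]] := set_0Vmem B.
  by rewrite cards0; apply: eq_card0 => x; rewrite !inE.
have [x xB maxx] := arg_maxnP (fun y : 'I_N => y : nat) zB.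
have {}xB : x \in B by [].
have {}maxx y : y \in B -> (y <= x)%N by apply: maxx.
rewrite (cardsD1 x B) xB /=; apply: eq_card => y; rewrite !inE andbC.
have [yB|//] := boolP (y \in B); last by rewrite !andbF.
rewrite !andbT; apply/exists_inP/idP => [[u uB yu]|yx].
  by apply: contraTneq yu => ->; rewrite -leqNgt; apply: maxx.
by exists x => //; rewrite ltn_neqAle maxx // andbT.
Qed.

Lemma nonmaxW N (B : {set 'I_N}) x : x \in nonmax B -> x \in B.
Proof. by rewrite in_set => /andP[]. Qed.

Lemma card_riordan_matchings N (P : {set {set 'I_N}}) : partition P [set: 'I_N] ->
  #|class_matching (pblock P) [set x | x \in nonmax (pblock P x)]|
  = (\prod_(B in P) matchings #|B|.-1)%N.
Proof.
move=> partP; rewrite card_class_matching [RHS]big_mkcond /=; apply: eq_bigr => B _.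
have covP x : x \in cover P by rewrite (cover_partition partP) inE.
(* A set that is not a block has an empty class, contributing [matchings 0], which is 1. *)
case: ifPn => BP; last first.
  rewrite (_ : [set _ in _ | _] = set0) ?cards0 //; apply/setP => x; rewrite !inE.
  by apply/negbTE; apply: contra BP => /andP[_ /eqP <-]; rewrite pblock_mem.
rewrite -card_nonmax; congr matchings; apply: eq_card => x; rewrite in_set [X in X && _]in_set.
apply/andP/idP => [[xB /eqP<-] // | xB].
have xinB := nonmaxW xB.
by rewrite (def_pblock (partition_trivIset partP) BP xinB).
Qed.

(** The blockwise conditions become one condition on [s] and the same one on [t], so that for fixed
    [P] the number of pairs is a square. *)
Lemma riordan_complexE N k (P : {set {set 'I_N}}) s t :
  let M := class_matching (pblock P) [set x | x \in nonmax (pblock P x)] in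
  riordan_complex k (P, s, t) =
  [&& partition P [set: 'I_N], #|P| == (2 * k + 1)%N,
      [forall B in P, odd #|B|], M s & M t].
Proof.
move=> M; rewrite /riordan_complex.
case: (boolP (partition P _)) => //= partP; congr [&& _, _ & _].
have covP x : x \in cover P by rewrite (cover_partition partP) inE.
have trivP := partition_trivIset partP.
have memP x : pblock P x \in P by rewrite pblock_mem.
have inP x : x \in pblock P x by rewrite mem_pblock.
have pbP B x : B \in P -> x \in B -> pblock P x = B by apply: def_pblock.
have AE x : (x \in [set y | y \in nonmax (pblock P y)]) = (x \in nonmax (pblock P x)).
  by rewrite in_set.
have matP s' : M s' = [forall B in P, fpf_invol_on (nonmax B) s'] &&
    [forall B in P, forall x in B, (x \notin nonmax B) ==> (s' x == x)].
  apply/class_matchingP/andP => [[h1 h2]|[/forall_inP h1 /forall_inP h2]].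
    split; apply/forall_inP => B BP; apply/forall_inP => x xB.
      have pBx := pbP B x BP (nonmaxW xB).
      have /h1[] : x \in [set y | y \in nonmax (pblock P y)] by rewrite AE pBx.
      by rewrite AE => hA -> -> hc; rewrite eqxx !andbT -pBx -hc.
    by apply/implyP => xN; rewrite h2 // AE (pbP B).
  split=> x; rewrite AE => hx.
    have /forall_inP/(_ x hx)/and3P[h -> /eqP->] := h1 _ (memP x).
    have e : pblock P (s' x) = pblock P x by apply: pbP => //; apply: nonmaxW.
    by rewrite AE e.
  by have /forall_inP/(_ x (inP x))/implyP/(_ hx)/eqP := h2 _ (memP x).
rewrite !matP.
apply/andP/andP => [[/forall_inP h1 /forall_inP h2]|].
  split; apply/andP; split; apply/forall_inP => B BP.
  - by have /andP[] := h1 B BP.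
  - apply/forall_inP => x xB; apply/implyP => hx.
    by have /forall_inP/(_ x xB)/implyP/(_ hx)/andP[] := h2 B BP.
  - by have /andP[] := h1 B BP.
  apply/forall_inP => x xB; apply/implyP => hx.
  by have /forall_inP/(_ x xB)/implyP/(_ hx)/andP[] := h2 B BP.
case=> /andP[/forall_inP s1 /forall_inP s2] /andP[/forall_inP t1 /forall_inP t2].
split; apply/forall_inP => B BP; first by rewrite s1 // t1.
apply/forall_inP => x xB; apply/implyP => hx; apply/andP; split.
  by have /forall_inP/(_ x xB)/implyP/(_ hx) := s2 B BP.
by have /forall_inP/(_ x xB)/implyP/(_ hx) := t2 B BP.
Qed.

Lemma matchings_odd n : odd n -> matchings n = 0%N.
Proof.
have [m] := ubnP n; elim: m n => // m IH [|[|n]] //= lt_nm.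
by rewrite negbK => /IH->; rewrite ?muln0 // -ltnS ltnW.
Qed.

Lemma card_riordan_complex N k :
  #|[pred c : {set {set 'I_N}} * {ffun 'I_N -> 'I_N} * {ffun 'I_N -> 'I_N}
     | riordan_complex k c]|%:Z = arcsin_pow int (2 * k + 1) N.
Proof.
rewrite -[N in RHS]card_ord -cardsT -partition_sum_arcsin /partition_sum.
rewrite -sum1_card (partition_big (fun c => c.1.1)
  (fun P => partition P [set: 'I_N] && (#|P| == (2 * k + 1)%N))) /=; last first.
  by case=> [[P s] t]; rewrite unfold_in /= => /and3P[-> -> _].
rewrite rmorph_sum /=; apply: eq_bigr => P /andP[partP cP].
rewrite (reindex_onto (fun st => (P, st.1, st.2)) (fun c => (c.1.2, c.2))) /=; last first.
  by case=> [[P' s] t] /= /andP[_ /eqP->].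
set M := class_matching (pblock P) [set x | x \in nonmax (pblock P x)].
transitivity ((\prod_(B in P) matchings #|B|.-1) ^ 2)%N%:Z; last first.
  rewrite /arcsin' -natr_prod natz; under [in RHS]eq_bigr do rewrite -mulnn.
  by rewrite big_split /= mulnn.
(* A block of even size leaves an odd number of non-maximal points, so its factor is 0 and the
   parity condition costs nothing. *)
congr Posz; have [odP|] := boolP [forall B in P, odd #|B|]; last first.
  move=> nodP; rewrite big_pred0 => [|st]; last first.
    by rewrite unfold_in riordan_complexE (negbTE nodP) !andbF.
  have [B BP /negbTE oB] := forall_inPn nodP.
  rewrite (bigD1 B) //= matchings_odd ?mul0n // -[odd _]negbK -oddS prednK ?oB //.
  by rewrite card_gt0 (partition_neq0 partP).
transitivity (\sum_(st in [predX M & M]) 1)%N.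
  apply: eq_bigl => -[s t]; rewrite !inE unfold_in riordan_complexE partP cP odP.
  by rewrite !eqxx !andbT.
by rewrite sum1_card cardX !card_riordan_matchings.
Qed.

Theorem theorem19 (n k : nat) :
  `|v n k|%N =
  #|[pred c : {set {set 'I_(2 * n + 1)}} * {ffun 'I_(2 * n + 1) -> 'I_(2 * n + 1)}
                * {ffun 'I_(2 * n + 1) -> 'I_(2 * n + 1)} | riordan_complex k c]|.
Proof.
(* In the recurrence of [v], raising n alone brings a minus sign, while raising n and k together
   keeps the sign. *)
suff e : v n k = (-1) ^+ (n + k) * arcsin_pow int (2 * k + 1) (2 * n + 1).
  by rewrite e -card_riordan_complex abszMsign.
elim: n k => [|n IH] k.
  rewrite !addn1 muln0 [RHS]/= /conv big_ord1 /= !mul1r.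
  by case: k => [|k]; rewrite ?mulr0 // mulr1.
rewrite [LHS]/= (_ : 2 * n.+1 + 1 = (2 * n + 1).+2)%N; last first.
  by rewrite mulnS -addnA.
rewrite [(2 * k + 1)%N]addn1 arcsin_pow_rec -[((_ ^ 2)%N)%:Z]natz natrX -[(2 * k).+1]addn1.
(* For k = 0 the predecessor series is y_(-1) = 0, matching v(n,-1) = 0. *)
case: k => [|k]; rewrite !IH.
  by rewrite muln0 !addn0 [_ ^+ n.+1]exprS [arcsin_pow_pred _ 0 _]/=; ring.
have -> : (n.+1 + k.+1 = (n + k).+2)%N by rewrite addSn addnS.
have -> : arcsin_pow_pred int (2 * k.+1) = arcsin_pow int (2 * k + 1)
  by rewrite mulnS addn1.
by rewrite (addnS n k) ![(-1) ^+ _.+1]exprS; ring.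
Qed.
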